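(* Let $n\in\mathbb N$, $\beta\ge0$, $\mathcal X=\{-n,\dots,n\}$, $\mathcal H(x)=-|x|$, and let $P_\beta$ be the Metropolis–Hastings kernel with nearest-neighbour simple random walk proposal and target $\pi_\beta(x)\propto e^{-\beta\mathcal H(x)}$. Let $G=\{e,g\}$ with $gx=-x$, and let $L_\beta=\frac12\big(I+((P_\beta)_{la})_{ra}\big)$. For $\varepsilon>0$, $$t_{\mathrm{mix},1}(L_\beta,\varepsilon)\le\frac{72n^3}{1-e^{-\beta}}\Big(\beta n+\log\Big(\frac{2n+1}{\varepsilon}\Big)\Big),$$ $$t_{\mathrm{mix},1}(P_\beta,\varepsilon)\ge\Big(\frac{e^{\beta n}}{(2n+1)^2}-1\Big)\log\Big(\frac1\varepsilon\Big).$$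
   Context: The proposal $P_0$ has $P_0(n,n)=P_0(-n,-n)=1/2$ and $P_0(x,x+1)=P_0(x+1,x)=1/2$ for $-n\le x\le n-1$. With $h_+=\max\{h,0\}$, for $-n\le x\le n-1$: $P_\beta(x,x+1)=\frac12e^{-\beta(\mathcal H(x+1)-\mathcal H(x))_+}$, $P_\beta(x+1,x)=\frac12e^{-\beta(\mathcal H(x)-\mathcal H(x+1))_+}$, other off-diagonal entries are $0$, and diagonal entries make the rows sum to one. $U_g[f](x)=f(gx)=f(-x)$, and $((P_\beta)_{la})_{ra}=\frac14\sum_{a,b\in G}U_aP_\beta U_b=\frac12P_\beta+\frac14U_gP_\beta+\frac14P_\beta U_g$. For a kernel $P$ stationary for $\pi=\pi_\beta$, $d_1(P,t)=\max_{x}\sum_{y}|P^t(x,y)-\pi(y)|$ and $t_{\mathrm{mix},1}(P,\varepsilon)=\inf\{t\in\mathbb N:d_1(P,t)\le\varepsilon\}$, with $\mathbb N=\{1,2,\dots\}$. For $\beta=0$ the first upper bound is read as $+\infty$.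
   Formalization: The bounds are proved for 0 < ε ≤ 2 instead of all ε > 0: since d_1 ≤ 2, the mixing time is 1 for ε ≥ 2, and both bounds can then fail (upper: n=1, β=1, ε=3e; lower: n=1, β=0, ε=e^2). *)

(* Defs.v *)
From mathcomp Require Import all_boot all_order all_algebra all_fingroup.
From mathcomp Require Import all_classical all_reals all_analysis.

Set Implicit Arguments.
Unset Strict Implicit.
Unset Printing Implicit Defensive.

Import Order.TTheory GRing.Theory Num.Theory.

Local Open Scope classical_set_scope.
Local Open Scope ring_scope.

(** A kernel on ['I_m] is a matrix with [P x y] the probability of moving from
    [x] to [y]; functions on ['I_m] are column vectors. *)

Section Kernels.
Context {R : realType}.

(** Metropolis-Hastings kernel with proposal [Q], assumed symmetric, and target
    [gibbs H beta]: the acceptance ratio [min 1 (pi y / pi x)] is then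
    [exp (- beta * (H y - H x)_+)]. *)
Definition metropolis_rate m (Q : 'M[R]_m) (H : 'I_m -> R) (beta : R)
    (x y : 'I_m) : R :=
  Q x y * expR (- (beta * Num.max (H y - H x) 0)).

Definition metropolis m (Q : 'M[R]_m) (H : 'I_m -> R) (beta : R) : 'M[R]_m :=
  \matrix_(x, y)
    if x == y then 1 - \sum_(z | z != x) metropolis_rate Q H beta x z
    else metropolis_rate Q H beta x y.

Definition gibbs m (H : 'I_m -> R) (beta : R) (x : 'I_m) : R :=
  expR (- (beta * H x)) / \sum_y expR (- (beta * H y)).

(** [(perm_mx a *m f) x 0 = f (a x) 0], so [perm_mx a] is the operator
    [U_a f x = f (a x)]. *)
Definition left_avg m (G : {set 'S_m}) (P : 'M[R]_m) : 'M[R]_m :=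
  #|G|%:R^-1 *: \sum_(a in G) (perm_mx a *m P).

Definition right_avg m (G : {set 'S_m}) (P : 'M[R]_m) : 'M[R]_m :=
  #|G|%:R^-1 *: \sum_(b in G) (P *m perm_mx b).

Definition d1 m (pi : 'I_m.+1 -> R) (P : 'M[R]_m.+1) (t : nat) : R :=
  \big[Num.max/0]_x \sum_y `|(P ^+ t) x y - pi y|.

(** Extended-real valued: the infimum is [+oo] if no [t >= 1] qualifies. *)
Definition tmix1 m (pi : 'I_m.+1 -> R) (P : 'M[R]_m.+1) (eps : R) : \bar R :=
  ereal_inf [set t%:R%:E | t in [set t : nat | (0 < t)%N /\ d1 pi P t <= eps]].

End Kernels.

(** The state space [{-n, ..., n}] is ['I_(n.*2.+1)], the index [i] standing
    for the integer [i - n]. *)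
Definition site (n : nat) (x : 'I_n.*2.+1) : int := x%:Z - n%:Z.

(** [site (rev_ord x) = - site x] *)
Definition reflection (n : nat) : 'S_n.*2.+1 := perm (@rev_ord_inj n.*2.+1).

Definition refl_group (n : nat) : {set 'S_n.*2.+1} := [set 1%g; reflection n].

Section DoubleWell.
Context {R : realType}.

Definition energy (n : nat) (x : 'I_n.*2.+1) : R := - (`|site x|)%:~R.

Definition walk_proposal (n : nat) : 'M[R]_n.*2.+1 :=
  \matrix_(x, y)
    if (site y == site x + 1) || (site x == site y + 1) then 2^-1
    else if (x == y) && ((site x == n%:Z) || (site x == - n%:Z)) then 2^-1
    else 0.

Definition pi_beta (n : nat) (beta : R) : 'I_n.*2.+1 -> R :=
  gibbs (@energy n) beta.

Definition P_beta (n : nat) (beta : R) : 'M[R]_n.*2.+1 :=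
  metropolis (walk_proposal n) (@energy n) beta.

Definition L_beta (n : nat) (beta : R) : 'M[R]_n.*2.+1 :=
  2^-1 *: (1%:M + right_avg (refl_group n)
                    (left_avg (refl_group n) (P_beta n beta))).

End DoubleWell.

Arguments pi_beta {R} n beta _.

(* Main.v *)
Require Import Defs.
From mathcomp Require Import all_boot all_order all_algebra all_fingroup.
From mathcomp Require Import all_classical all_reals all_analysis.
From mathcomp Require Import zify ring lra.

Import Order.TTheory GRing.Theory Num.Theory.

Local Open Scope ring_scope.

(** The reflection splits functions on the sites into even and odd ones, and
    the Metropolis kernel preserves both classes.  On each it acts as a
    birth-death operator in the distance [k] to the centre
    ([P_beta_profile]); for [0 < k < n] this operator moves up with probability
    [1 / 2] and down with probability [a / 2], where [a = expR (- beta)].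

    Upper bound.  Group averaging annihilates the odd functions, so [L_beta]
    merely halves them ([L_beta_odd]), and it acts on the even ones as the lazy
    reflected walk ([L_beta_even]).  That walk drifts towards [n], and giving
    the edge [{k, k.+1}] the length [n - k] makes it a strict contraction: the
    Lipschitz constant shrinks by [1 - (1 - a) / (4 * n)] at each step
    ([slope_le_contract]).  Hence oscillations of [L_beta ^ t f] decay
    geometrically ([L_beta_osc]), and by duality and stationarity so does the
    distance to equilibrium ([d1_le]).  The relaxation time [4 * n / (1 - a)]
    found in this way leaves a factor of order [n ^ 2] to spare, which absorbs
    all the other losses.

    Lower bound.  The obstruction to mixing is odd: going from one well to the
    other means crossing the centre.  The function
    [geo_sum a k = 1 + a + ... + a ^ (k - 1)], extended to be odd, is harmonic
    for the walk killed at the centre except at the two extreme sites, where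
    it loses a fraction at most [a ^ n / 2].  So it decays no faster than
    [(1 - a ^ n / 2) ^ t], and, having mean zero, it keeps the distance to
    equilibrium above that ([P_beta_slow]). *)

(** * Metropolis kernels and distance to stationarity *)

Section Kernels.
Context {R : realType}.

(** Writing the kernel as identity plus generator makes the diagonal entries,
    and the self-loops of the proposal, drop out of every computation. *)
Lemma metropolis_generator m (Q : 'M[R]_m) (H : 'I_m -> R) (beta : R)
    (f : 'cV[R]_m) (x : 'I_m) :
  (metropolis Q H beta *m f) x 0
    = f x 0 + \sum_y metropolis_rate Q H beta x y * (f y 0 - f x 0).
Proof.
rewrite mxE (bigD1 x) //= mxE eqxx mulrBl mul1r mulr_suml.
rewrite [in RHS](bigD1 x) //= subrr mulr0 add0r -addrA; congr (_ + _).
rewrite addrC -sumrB; apply: eq_bigr => y yx.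
by rewrite mxE eq_sym (negPf yx) mulrBr.
Qed.

(** Detailed balance: for symmetric [Q] the flow from [x] to [y] is
    [Q x y * expR (- (beta * max (H x) (H y)))] up to normalisation. *)
Lemma metropolis_stationary m (Q : 'M[R]_m) (H : 'I_m -> R) (beta : R) :
  (forall x y, Q x y = Q y x) ->
  (\row_x gibbs H beta x) *m metropolis Q H beta = \row_x gibbs H beta x.
Proof.
move=> Qsym.
have reversible x y : gibbs H beta x * metropolis_rate Q H beta x y
                    = gibbs H beta y * metropolis_rate Q H beta y x.
  rewrite /gibbs /metropolis_rate Qsym.
  set Z := (\sum_z _)^-1; set q := Q y x.
  rewrite -[_ * Z * _]mulrA -[_ * Z * _ in RHS]mulrA ![Z * _]mulrC.
  rewrite ![(q * _) * Z]mulrAC ![_ * (q * Z * _)]mulrCA; congr (_ * _).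
  rewrite -!expRD; congr expR; rewrite -!mulrN -!mulrDr; congr (_ * _).
  by case: (lerP (H y - H x) 0) => h1; case: (lerP (H x - H y) 0) => h2; lra.
apply/rowP => y; rewrite !mxE (bigD1 y) //= !mxE eqxx mulrBr mulr1 -addrA.
rewrite -[RHS]addr0; congr (_ + _); rewrite mulr_sumr addrC -sumrB.
by apply: big1 => x xy; rewrite !mxE (negPf xy) reversible subrr.
Qed.

Lemma gibbs_ge0 m (H : 'I_m -> R) (beta : R) x : 0 <= gibbs H beta x.
Proof. by rewrite divr_ge0 ?expR_ge0 ?sumr_ge0 // => y _; exact: expR_ge0. Qed.

Lemma gibbs_sum m (H : 'I_m.+1 -> R) (beta : R) : \sum_x gibbs H beta x = 1.
Proof.
rewrite -mulr_suml divff // gt_eqF // (bigD1 ord0) //= ltr_wpDr ?expR_gt0 //.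
by apply: sumr_ge0 => y _; exact: expR_ge0.
Qed.

Lemma avg_stationary m (G : {set 'S_m}) (P : 'M[R]_m) (p : 'rV[R]_m) :
  (0 < #|G|)%N -> (forall s, s \in G -> p *m perm_mx s = p) -> p *m P = p ->
  p *m right_avg G (left_avg G P) = p.
Proof.
move=> G0 pG pP; have G1 : #|G|%:R^-1 *: (p *+ #|G|) = p.
  by rewrite -(scaler_nat _ p) scalerA mulVf ?scale1r // pnatr_eq0 -lt0n.
have pL : p *m left_avg G P = p.
  rewrite /left_avg -scalemxAr mulmx_sumr (eq_bigr (fun=> p)) ?sumr_const //.
  by move=> s /pG ps; rewrite mulmxA ps.
rewrite /right_avg -scalemxAr mulmx_sumr (eq_bigr (fun=> p)) ?sumr_const //.
by move=> s /pG ps; rewrite mulmxA pL.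
Qed.

(** The [l^1] distance is dual to the sup norm: testing [P^t(x, _) - p] against
    its own sign [f] and using [p P^t = p] gives the average over [z ~ p] of
    [P^t f x - P^t f z], so controlling oscillations is enough. *)
Lemma d1_le m (p : 'I_m.+1 -> R) (P : 'M[R]_m.+1) (t : nat) (c : R) :
    0 <= c -> (forall x, 0 <= p x) -> \sum_x p x = 1 ->
    (\row_x p x) *m P = \row_x p x ->
    (forall (f : 'cV[R]_m.+1) x z, (forall y, `|f y 0| <= 1) ->
       (P ^+ t *m f) x 0 - (P ^+ t *m f) z 0 <= c) ->
  d1 p P t <= c.
Proof.
move=> c0 p0 p1 pP osc; apply: bigmax_le => // x _.
have pPt : (\row_x p x) *m P ^+ t = \row_x p x.
  elim: t {osc} => [|t IH]; first by rewrite expr0 mulmx1.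
  by rewrite exprS -mulmxE mulmxA pP.
pose f : 'cV[R]_m.+1 := \col_y Num.sg ((P ^+ t) x y - p y).
have f1 y : `|f y 0| <= 1 by rewrite mxE normr_sg lern1 leq_b1.
have -> : \sum_y `|(P ^+ t) x y - p y|
    = \sum_z p z * ((P ^+ t *m f) x 0 - (P ^+ t *m f) z 0).
  rewrite (eq_bigr (fun y => (P ^+ t) x y * f y 0 - p y * f y 0)); last first.
    by move=> y _; rewrite -mulrBl [f y 0]mxE normrEsg mulrC.
  under [RHS]eq_bigr do rewrite mulrBr.
  rewrite !sumrB -mulr_suml p1 mul1r mxE; congr (_ - _).
  transitivity (((\row_x p x) *m P ^+ t *m f) 0 0).
    by rewrite pPt [RHS]mxE; apply: eq_bigr => y _; rewrite [in RHS]mxE.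
  by rewrite -mulmxA mxE; apply: eq_bigr => y _; rewrite [(\row_x p x) 0 y]mxE.
rewrite -[c]mul1r -p1 mulr_suml; apply: ler_sum => z _.
exact: ler_wpM2l (osc _ _ _ f1).
Qed.

(** The other half of the duality: any test function of mean zero bounds the
    distance from below. *)
Lemma le_d1 m (p : 'I_m.+1 -> R) (P : 'M[R]_m.+1) (t : nat)
    (f : 'cV[R]_m.+1) (x : 'I_m.+1) (b : R) :
    (forall y, `|f y 0| <= b) -> \sum_y p y * f y 0 = 0 ->
  (P ^+ t *m f) x 0 <= d1 p P t * b.
Proof.
move=> fb pf; rewrite mxE -[X in X <= _]subr0 -[X in _ - X <= _]pf -sumrB.
apply: (@le_trans _ _ ((\sum_y `|(P ^+ t) x y - p y|) * b)).
  rewrite mulr_suml; apply: ler_sum => y _; rewrite -mulrBl.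
  by apply: le_trans (ler_norm _) _; rewrite normrM ler_wpM2l.
apply: ler_wpM2r; first exact: le_trans (normr_ge0 _) (fb x).
exact: (@le_bigmax _ _ _ 0 (fun x => \sum_y `|(P ^+ t) x y - p y|)).
Qed.

End Kernels.

(** * The double-well walk on even and odd functions *)

Section Walk.
Context {R : realType}.
Implicit Types (n : nat) (beta s : R) (h : nat -> R).

(** The distance [`|i - n|] to the centre, by truncated subtractions, so that it
    stays in [nat]. *)
Definition height (n i : nat) : nat := (i - n + (n - i))%N.

Lemma energyE n (x : 'I_n.*2.+1) : energy x = - (height n x)%:R :> R.
Proof.
rewrite /energy -natr_absz; congr (- _%:R); rewrite /site /height; lia.
Qed.

(** The condition [g x = 0] absorbs the self-loops of the proposal at the two
    endpoints. *)
Lemma walk_sum n (x : 'I_n.*2.+1) (g : nat -> R) : g x = 0 ->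
  \sum_y walk_proposal n x y * g y
    = 2^-1 * ((if (x.+1 < n.*2.+1)%N then g x.+1 else 0)
              + (if (0 < x)%N then g x.-1 else 0)).
Proof.
move=> gx.
transitivity (\sum_(y < n.*2.+1) ((if y == x.+1 :> nat then 2^-1 * g y else 0)
    + (if (0 < x)%N && (y == x.-1 :> nat) then 2^-1 * g y else 0))).
  apply: eq_bigr => y _; rewrite mxE.
  have -> : (site y == site x + 1) || (site x == site y + 1)
      = (y == x.+1 :> nat) || (0 < x)%N && (y == x.-1 :> nat).
    by rewrite /site; lia.
  case: (eqVneq (y : nat) x.+1) => [->|_] /=.
    by have -> : (x.+1 == x.-1 :> nat) = false by [lia]; rewrite andbF addr0.
  case: ifP => _; rewrite add0r //; case: ifP => [/andP[/eqP<- _]|_].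
    by rewrite gx mulr0.
  by rewrite mul0r.
rewrite big_split /= -big_mkcond /=.
rewrite (big_ord1_eq _ (fun y => 2^-1 * g y)) mulrDr; congr (_ + _).
  by case: ifP; rewrite ?mulr0.
case: posnP => x0 /=; first by rewrite big1 ?mulr0.
rewrite -big_mkcond /= (big_ord1_eq _ (fun y => 2^-1 * g y)).
by rewrite (leq_ltn_trans (leq_pred x)).
Qed.

Lemma P_beta_apply n beta (f : nat -> R) (x : 'I_n.*2.+1) : 0 <= beta ->
  (P_beta n beta *m \col_y f y) x 0
    = f x + 2^-1 *
      ((if (x < n.*2)%N
        then (if (n <= x)%N then 1 else expR (- beta)) * (f x.+1 - f x) else 0)
       + (if (0 < x)%N
          then (if (x <= n)%N then 1 else expR (- beta)) * (f x.-1 - f x)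
          else 0)).
Proof.
move=> b0; rewrite metropolis_generator mxE; congr (_ + _).
pose g k := expR (- (beta * Num.max ((height n x)%:R - (height n k)%:R) 0))
            * (f k - f x).
rewrite (eq_bigr (fun y : 'I_n.*2.+1 => walk_proposal n x y * g y)); last first.
  move=> y _; rewrite [(\col_i f i) y 0]mxE.
  rewrite /metropolis_rate !energyE opprK [- _ + _]addrC.
  by rewrite -mulrA.
have down j k : (height n j <= height n k)%N ->
    expR (- (beta * Num.max ((height n j)%:R - (height n k)%:R) 0)) = 1.
  move=> jk; rewrite (_ : Num.max _ _ = 0) ?mulr0 ?oppr0 ?expR0 //.
  by apply/max_idPr; rewrite subr_le0 ler_nat.
have up j k : height n j = (height n k).+1 ->
    expR (- (beta * Num.max ((height n j)%:R - (height n k)%:R) 0))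
    = expR (- beta).
  move=> ->; rewrite -addn1 natrD addrAC subrr add0r.
  by rewrite (_ : Num.max _ _ = 1) ?mulr1 //; apply/max_idPl.
rewrite walk_sum; last by rewrite /g [f x - _]subrr mulr0.
congr (_ * (_ + _)).
  rewrite ltnS; case: ifP => // _; rewrite /g; congr (_ * _).
  case: leqP => nx; first by rewrite down // /height; lia.
  by rewrite up // /height; lia.
case: posnP => // x0; rewrite /g; congr (_ * _).
case: leqP => nx; first by rewrite down // /height; lia.
by rewrite up // /height; lia.
Qed.

(** With [s = 1] and [s = -1] these are the even and the odd functions of the
    site, [h] being the values on the nonnegative sites.  In the odd case this
    requires [h 0 = 0], which is phrased as [s * h 0 = h 0] to treat both
    parities at once. *)
Definition profile n s h : 'cV[R]_n.*2.+1 :=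
  \col_x ((if (x < n)%N then s else 1) * h (height n x)).

(** The walk seen on the distance to the centre: a birth-death operator on
    [{0, ..., n}], with reflection ([s = 1]) or killing ([s = -1]) at [0]. *)
Definition profile_step n (a s : R) h (k : nat) : R :=
  if k is j.+1 then
    h k + 2^-1 * ((if (k < n)%N then h k.+1 - h k else 0) + a * (h j - h k))
  else (1 + s) / 2 * h 1%N.

(** The landscape is symmetric, so the kernel preserves parity and reduces to a
    birth-death operator on each parity class. *)
Lemma P_beta_profile n beta s h :
    (0 < n)%N -> 0 <= beta -> s * s = 1 -> s * h 0%N = h 0%N ->
  P_beta n beta *m profile n s h
    = profile n s (profile_step n (expR (- beta)) s h).
Proof.
move=> n0 b0 ss sh; apply/colP => x.
pose f i := (if (i < n)%N then s else 1) * h (height n i).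
rewrite (P_beta_apply n beta f) // /f.
rewrite [RHS]mxE.
case: (ltngtP x n) => xn.
- have -> : height n x = (n - x).-1.+1 by rewrite /height; lia.
  have -> : (x < n.*2)%N by lia.
  have -> : height n x.+1 = (n - x).-1 by rewrite /height; lia.
  have -> : (x.-1 < n)%N by lia.
  rewrite /profile_step.
  have -> : ((n - x).-1.+1 < n)%N = (0 < x)%N by lia.
  set X := (if (x.+1 < n)%N then s else 1) * _.
  have -> : X = s * h (n - x).-1.
    rewrite /X; case: ifP => // xn1.
    by have -> : (n - x).-1 = 0%N by [lia]; rewrite mul1r sh.
  case: ifP => x0; last by ring.
  have -> : height n x.-1 = (n - x).-1.+2 by rewrite /height; lia.
  by ring.
- have -> : height n x = (x - n).-1.+1 by rewrite /height; lia.
  have -> : height n x.+1 = (x - n).-1.+2 by rewrite /height; lia.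
  have -> : height n x.-1 = (x - n).-1 by rewrite /height; lia.
  have -> : (0 < x)%N by lia.
  have -> : (x.+1 < n)%N = false by lia.
  have -> : (x.-1 < n)%N = false by lia.
  rewrite /profile_step.
  have -> : ((x - n).-1.+1 < n)%N = (x < n.*2)%N by lia.
  by case: ifP => _; ring.
- rewrite xn; have -> : height n n = 0%N by rewrite /height; lia.
  have -> : height n n.+1 = 1%N by rewrite /height; lia.
  have -> : height n n.-1 = 1%N by rewrite /height; lia.
  have -> : (n < n.*2)%N by lia.
  have -> : (n.-1 < n)%N by lia.
  have -> : (n.+1 < n)%N = false by lia.
  by rewrite n0 /=; field.
Qed.

Lemma reflectE n (f : 'cV[R]_n.*2.+1) x :
  (perm_mx (reflection n) *m f) x 0 = f (rev_ord x) 0.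
Proof. by rewrite -row_permE mxE permE. Qed.

Lemma height_rev n (x : 'I_n.*2.+1) : height n (rev_ord x) = height n x.
Proof. by have := ltn_ord x; rewrite /height /=; lia. Qed.

Lemma reflect_profile n s h : s * s = 1 -> s * h 0%N = h 0%N ->
  perm_mx (reflection n) *m profile n s h = s *: profile n s h.
Proof.
move=> ss sh; apply/colP => x; rewrite reflectE !mxE height_rev.
have xle := ltn_ord x.
rewrite /= subSS; case: (ltngtP x n) => xn.
- have -> : (n.*2 - x < n)%N = false by lia.
  by rewrite mulrA ss.
- by have -> : (n.*2 - x < n)%N by [lia]; rewrite mul1r.
- have -> : (n.*2 - x < n)%N = false by lia.
  have -> : height n x = 0%N by rewrite /height; lia.
  by rewrite !mul1r sh.
Qed.

Lemma walk_proposal_sym n (x y : 'I_n.*2.+1) :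
  walk_proposal n x y = walk_proposal n y x :> R.
Proof.
rewrite !mxE orbC; case: ifP => // _; rewrite eq_sym.
by case: eqVneq => [->|].
Qed.

Lemma reflection_neq1 n : (0 < n)%N -> 1%g \notin [set reflection n]%SET.
Proof.
move=> n0; rewrite inE; apply/eqP => /permP /(_ ord0).
by rewrite perm1 permE => /(congr1 val) /=; lia.
Qed.

Lemma sum_refl_group n (V : zmodType) (F : 'S_n.*2.+1 -> V) : (0 < n)%N ->
  \sum_(s in refl_group n) F s = F 1%g + F (reflection n).
Proof. by move=> n0; rewrite big_setU1 ?reflection_neq1 ?big_set1. Qed.

Lemma card_refl_group n : (0 < n)%N -> #|refl_group n| = 2%N.
Proof. by move=> n0; rewrite cardsU1 reflection_neq1 ?cards1. Qed.

Lemma pi_beta_rev n beta (x : 'I_n.*2.+1) :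
  pi_beta n beta (rev_ord x) = pi_beta n beta x.
Proof. by rewrite /pi_beta /gibbs !energyE height_rev. Qed.

Lemma half_double (V : lmodType R) (v : V) : 2^-1 *: (v + v) = v.
Proof. by rewrite -mulr2n -(scaler_nat 2 v) scalerA mulVf ?scale1r. Qed.

Lemma L_beta_stationary n beta : (0 < n)%N ->
  (\row_x pi_beta n beta x) *m L_beta n beta = \row_x pi_beta n beta x.
Proof.
move=> n0; set p := \row_x _; rewrite /L_beta -scalemxAr mulmxDr mulmx1.
rewrite avg_stationary; first by exact: half_double.
- by rewrite card_refl_group.
- move=> s; rewrite !inE => /orP[]/eqP->; first by rewrite perm_mx1 mulmx1.
  rewrite -[reflection n]invgK -col_permE; apply/rowP => x; rewrite !mxE.
  have -> : (reflection n)^-1%g x = rev_ord x.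
    by apply: (@perm_inj _ (reflection n)); rewrite permKV permE rev_ordK.
  exact: pi_beta_rev.
- exact/metropolis_stationary/walk_proposal_sym.
Qed.

(** Both averages fix even functions, so on them [L_beta] is the lazy version
    of the reflected walk, whose energy landscape has no barrier left. *)
Lemma L_beta_even n beta h : (0 < n)%N -> 0 <= beta ->
  L_beta n beta *m profile n 1 h
    = profile n 1
        (fun k => (h k + profile_step n (expR (- beta)) 1 h k) / 2).
Proof.
move=> n0 b0; set K := profile_step _ _ _ h.
have U g : perm_mx (reflection n) *m profile n 1 g = profile n 1 g.
  by rewrite reflect_profile ?scale1r ?mul1r.
have PK : P_beta n beta *m profile n 1 h = profile n 1 K.
  by rewrite P_beta_profile ?mul1r.
have LA : left_avg (refl_group n) (P_beta n beta) *m profile n 1 h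
    = profile n 1 K.
  rewrite /left_avg -scalemxAl mulmx_suml sum_refl_group // card_refl_group //.
  by rewrite -!mulmxA PK U perm_mx1 mul1mx half_double.
rewrite /L_beta -scalemxAl mulmxDl mul1mx.
have -> : right_avg (refl_group n) (left_avg (refl_group n) (P_beta n beta))
    *m profile n 1 h = profile n 1 K.
  rewrite /right_avg -scalemxAl mulmx_suml sum_refl_group // card_refl_group //.
  by rewrite -!mulmxA U perm_mx1 mul1mx LA half_double.
by apply/colP => x; rewrite !mxE !if_same; field.
Qed.

(** Averaging over the reflection kills odd functions: only the lazy half
    remains, so the slow mode of [P_beta] has become a fast one. *)
Lemma L_beta_odd n beta (f : 'cV[R]_n.*2.+1) : (0 < n)%N ->
  perm_mx (reflection n) *m f = - f -> L_beta n beta *m f = 2^-1 *: f.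
Proof.
move=> n0 fodd; rewrite /L_beta -scalemxAl mulmxDl mul1mx /right_avg.
rewrite -[X in _ + X]scalemxAl mulmx_suml sum_refl_group // -!mulmxA fodd.
by rewrite perm_mx1 mul1mx -mulmxDr subrr mulmx0 scaler0 addr0.
Qed.

End Walk.

(** * Rapid mixing of the averaged kernel *)

Section Contraction.
Context {R : realType}.
Implicit Types (n : nat) (a beta c eps : R) (h : nat -> R).

(** A Lipschitz condition for the metric in which the edge [{k, k.+1}] has
    length [n - k]. *)
Definition slope_le n c h :=
  forall k, (k < n)%N -> `|h k.+1 - h k| <= c * (n - k)%:R.

(** The increments [g k = h k.+1 - h k] of the image under the lazy step are
    combinations of [g k], [g k.+1] and [g k.-1] with nonnegative coefficients
    (laziness is what makes the coefficient of [g 0] nonnegative).  Away from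
    the ends these are [1 - (1 + a) / 4], [1 / 4] and [a / 4]; applied to the
    weights [n - k] they give [(n - k) - (1 - a) / 4], because the upward rate
    beats the downward one, and [n - k <= n] turns this loss into a factor. *)
Lemma slope_le_contract n a c h :
    (0 < n)%N -> 0 <= a -> a <= 1 -> 0 <= c -> slope_le n c h ->
  slope_le n ((1 - (1 - a) / (4 * n%:R)) * c)
    (fun k => (h k + profile_step n a 1 h k) / 2).
Proof.
move=> n0 a0 a1 c0 hc; set h' := (X in slope_le _ _ X); move=> k kn.
have nR : 0 < n%:R :> R by rewrite ltr0n.
set K := 1 - _.
have combine u v w p q r U V W : 0 <= p -> 0 <= q -> 0 <= r ->
    `|u| <= U -> `|v| <= V -> `|w| <= W ->
    `|p * u + q * v + r * w| <= p * U + q * V + r * W :> R.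
  move=> p0 q0 r0 uU vV wW.
  rewrite (le_trans (ler_normD _ _)) // lerD ?(le_trans (ler_normD _ _)) //.
    by rewrite lerD // normrM ger0_norm // ler_wpM2l.
  by rewrite normrM ger0_norm // ler_wpM2l.
(* the increment to the right of [k], absent when [k.+1 = n] *)
pose g1 := if (k.+1 < n)%N then h k.+2 - h k.+1 else 0.
have g1c : `|g1| <= c * (n - k.+1)%:R.
  rewrite /g1; case: ifP => [/hc//|_].
  by rewrite normr0 mulr_ge0.
have Knk : (n - k)%:R - (1 - a) / 4 <= K * (n - k)%:R :> R.
  have : (1 - a) / (4 * n%:R) * (n - k)%:R <= (1 - a) / 4.
    rewrite invfM -!mulrA ler_wpM2l ?subr_ge0 // ler_piMr //.
    by rewrite mulrC ler_pdivrMr // mul1r ler_nat leq_subr.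
  by rewrite /K [(1 - _) * _]mulrBl mul1r lerD2l lerN2.
apply: le_trans (_ : c * ((n - k)%:R - (1 - a) / 4) <= _); last first.
  by rewrite [K * c]mulrC -mulrA ler_wpM2l.
have nk : (n - k)%:R = (n - k.+1)%:R + 1 :> R by rewrite natr1; congr _%:R; lia.
case: k => [|k] in kn g1 g1c Knk nk *.
  have -> : h' 1%N - h' 0%N
      = (1 / 2 - a / 4) * (h 1%N - h 0%N) + 4^-1 * g1 + 0 * 0.
    by rewrite /h' /profile_step /g1; case: ifP => _; field.
  apply: le_trans
    (combine _ _ _ _ _ _ _ _ _ _ _ _ (hc _ kn) g1c (_ : _ <= 0)) _;
    rewrite ?normr0 //; first lra.
  have : 0 <= (n - 1)%:R :> R by [].
  move: nk; set x := (n - 0)%:R; set y := (n - 1)%:R => -> y0.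
  have := mulr_ge0 a0 (mulr_ge0 c0 y0); have := mulr_ge0 a0 c0.
  by have := mulr_ge0 c0 y0; lra.
have -> : h' k.+2 - h' k.+1 = (1 - (1 + a) / 4) * (h k.+2 - h k.+1)
    + 4^-1 * g1 + (a / 4) * (h k.+1 - h k).
  by rewrite /h' /profile_step kn /g1; case: ifP => _; field.
apply: le_trans (combine _ _ _ _ _ _ _ _ _ _ _ _ (hc _ kn) g1c
  (hc k (ltnW kn))) _; first lra; first by []; first lra.
have -> : (n - k)%:R = (n - k.+1)%:R + 1 :> R by rewrite natr1; congr _%:R; lia.
rewrite nk; set y := (n - k.+2)%:R.
by rewrite le_eqVlt; apply/orP; left; apply/eqP; field.
Qed.

(** At most [n] increments separate two points, each at most [c * n]. *)
Lemma slope_le_osc n c h j k :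
  0 <= c -> slope_le n c h -> (j <= n)%N -> (k <= n)%N ->
  h j - h k <= c * n%:R ^+ 2.
Proof.
move=> c0 hc jn kn; apply: le_trans (ler_norm _) _.
wlog jk : j k jn kn / (j <= k)%N => [sym|].
  by case/orP: (leq_total j k) => ?; [|rewrite distrC]; exact: sym.
have walk i d : (i + d <= n)%N -> `|h (i + d)%N - h i| <= c * n%:R * d%:R.
  elim: d => [|d IH] idn; first by rewrite addn0 subrr normr0 mulr0.
  rewrite addnS -(subrKA (h (i + d)%N)) (le_trans (ler_normD _ _)) //.
  rewrite -natr1 mulrDr mulr1 addrC lerD ?IH ?hc //; try lia.
  by rewrite (le_trans (hc _ _)) ?ler_wpM2l ?ler_nat ?leq_subr //; lia.
rewrite -(subnKC jk) distrC (le_trans (walk _ _ _)) ?subnKC //.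
by rewrite expr2 mulrA ler_wpM2l ?mulr_ge0 // ler_nat; lia.
Qed.

(** Split [f] into its even and odd parts.  The even part starts with slopes at
    most [2] and contributes [2 * n ^ 2] times the contraction factor; the odd
    part contributes at most [2] times [2 ^ - t], which is smaller. *)
Lemma L_beta_osc n beta t (f : 'cV[R]_n.*2.+1) x z :
    (0 < n)%N -> 0 <= beta -> (forall y, `|f y 0| <= 1) ->
  (L_beta n beta ^+ t *m f) x 0 - (L_beta n beta ^+ t *m f) z 0
    <= (2 * n%:R ^+ 2 + 2) * (1 - (1 - expR (- beta)) / (4 * n%:R)) ^+ t.
Proof.
move=> n0 b0 f1; set a := expR (- beta); set r := 1 - _.
have a0 : 0 <= a by exact: expR_ge0.
have a1 : a <= 1 by rewrite -expR0 ler_expR oppr_le0.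
have nR : 1 <= n%:R :> R by rewrite ler1n.
have r2 : 2^-1 <= r.
  have : (1 - a) / (4 * n%:R) <= 2^-1 by rewrite ler_pdivrMr; nra.
  by rewrite /r; lra.
pose U : 'M[R]_n.*2.+1 := perm_mx (reflection n).
pose h k := (f (inord (n + k)) 0 + f (inord (n - k)) 0) / 2.
pose fo := f - profile n 1 h.
have hE y : (profile n 1 h) y 0 = (f y 0 + f (rev_ord y) 0) / 2.
  rewrite mxE if_same mul1r /h.
  have yn := ltn_ord y.
  have [yge|ylt] := leqP n y.
    have -> : inord (n + height n y) = y.
      by apply: val_inj; rewrite /= inordK /height; lia.
    have -> // : inord (n - height n y) = rev_ord y.
      by apply: val_inj; rewrite /= inordK /height; lia.
  have -> : inord (n - height n y) = y.
    by apply: val_inj; rewrite /= inordK /height; lia.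
  have -> // : inord (n + height n y) = rev_ord y.
    by apply: val_inj; rewrite /= inordK /height; lia.
  by rewrite addrC.
have oE y : fo y 0 = (f y 0 - f (rev_ord y) 0) / 2.
  by rewrite [LHS]mxE [X in _ + X = _]mxE hE; field.
have oodd : U *m fo = - fo.
  by apply/colP => y; rewrite reflectE [RHS]mxE !oE rev_ordK; field.
have o1 y : `|fo y 0| <= 1.
  rewrite oE normrM [`|2^-1|]ger0_norm // ler_pdivrMr // mul1r.
  by rewrite (le_trans (ler_normB _ _)) // -[2]/(1 + 1) lerD.
have h1 k : `|h k| <= 1.
  rewrite /h normrM [`|2^-1|]ger0_norm // ler_pdivrMr // mul1r.
  by rewrite (le_trans (ler_normD _ _)) // -[2]/(1 + 1) lerD.
have hslope : slope_le n 2 h.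
  move=> k kn; rewrite (le_trans (ler_normB _ _)) //.
  rewrite (le_trans (lerD (h1 _) (h1 _))) // -[1 + 1]mulr1 ler_wpM2l //.
  by rewrite ler1n subn_gt0.
have odd_pow : L_beta n beta ^+ t *m fo = 2^-1 ^+ t *: fo.
  elim: t => [|t IH]; first by rewrite expr0 mul1mx scale1r.
  rewrite exprS -mulmxE -mulmxA IH -scalemxAr L_beta_odd //.
  by rewrite scalerA exprSr.
have [h' [even_pow h'slope]] : exists h',
    L_beta n beta ^+ t *m profile n 1 h = profile n 1 h'
    /\ slope_le n (r ^+ t * 2) h'.
  elim: t {odd_pow} => [|t [g [gE gslope]]].
    by exists h; rewrite !expr0 mul1mx mul1r.
  exists (fun k => (g k + profile_step n a 1 g k) / 2); split.
    by rewrite exprS -mulmxE -mulmxA gE L_beta_even.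
  rewrite exprS -mulrA; apply: slope_le_contract => //.
  by rewrite mulr_ge0 ?exprn_ge0 //; lra.
have -> : f = profile n 1 h + fo by rewrite addrC subrK.
have split_at y : (profile n 1 h' + 2^-1 ^+ t *: fo) y 0
    = h' (height n y) + 2^-1 ^+ t * fo y 0.
  by rewrite [LHS]mxE [X in X + _]mxE [X in _ + X = _]mxE if_same mul1r.
rewrite mulmxDr even_pow odd_pow !split_at.
have hle (y : 'I_n.*2.+1) : (height n y <= n)%N.
  by have := ltn_ord y; rewrite /height; lia.
have r0 : 0 <= r ^+ t by rewrite exprn_ge0 //; lra.
have hosc := slope_le_osc _ _ _ _ _ (mulr_ge0 r0 (ler0n _ 2)) h'slope
  (hle x) (hle z).
have ro : 2^-1 ^+ t <= r ^+ t by apply: lerXn2r; rewrite // nnegrE; lra.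
have hfo : 2^-1 ^+ t * (fo x 0 - fo z 0) <= 2^-1 ^+ t * 2.
  apply: ler_wpM2l; first exact: exprn_ge0.
  by have := o1 x; have := o1 z; rewrite !ler_norml; lra.
lra.
Qed.

Lemma ln_leB1 (x : R) : 0 < x -> ln x <= x - 1.
Proof. by move=> x0; rewrite -[in ln x](addrNK 1 x) addrC le_ln1Dx; lra. Qed.

(** With contraction rate [k = (1 - a) / (4 * n)] and
    [l = ln ((2 * n + 1) / eps)], the time [2 * l / k] makes the distance at
    most [(2 * n ^ 2 + 2) * (eps / (2 * n + 1)) ^ 2 <= eps].  The claimed bound
    exceeds [2 * l / k] by far more than the [1] lost in rounding up, because
    [eps <= 2] keeps [l] above [1 / 3]. *)
Lemma tmix1_L_beta_le n beta eps :
    (0 < n)%N -> 0 < beta -> 0 < eps -> eps <= 2 ->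
  (tmix1 (pi_beta n beta) (L_beta n beta) eps
     <= (72 * n%:R ^+ 3 / (1 - expR (- beta))
         * (beta * n%:R + ln ((2 * n%:R + 1) / eps)))%:E)%E.
Proof.
move=> n_gt0 bgt0 eps_gt0 eps_le2; have beta_ge0 := ltW bgt0.
have n1 : 1 <= n%:R :> R by rewrite ler1n.
have m0 : 0 < 2 * n%:R + 1 :> R by lra.
set a := expR (- beta).
have a1 : 0 < 1 - a by rewrite subr_gt0 -expR0 ltr_expR oppr_lt0.
have age0 : 0 <= a by exact: expR_ge0.
set l := ln _; set k := (1 - a) / (4 * n%:R).
have l3 : 3^-1 <= l.
  have e23 : eps / (2 * n%:R + 1) <= 2 / 3.
    rewrite ler_pdivrMr //; lra.
  have e0 : 0 < eps / (2 * n%:R + 1) by rewrite divr_gt0.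
  have := ln_leB1 _ e0; rewrite /l -[(2 * _ + 1) / _]invf_div lnV ?posrE //.
  lra.
have k0 : 0 < k by rewrite divr_gt0 //; lra.
have k1 : k <= 4^-1.
  by rewrite /k ler_pdivrMr; lra.
pose y := 2 * l / k; pose t := (Num.truncn y).+1.
have y0 : 0 <= y by rewrite /y divr_ge0 //; lra.
have /andP[ty yt] := truncn_itv y0; rewrite -/t in yt.
apply: (@le_trans _ _ (t%:R%:E)).
  apply: ereal_inf_lbound; exists t => //; split=> //.
  apply: d1_le.
  + by apply: ltW.
  + by move=> x; exact: gibbs_ge0.
  + exact: gibbs_sum.
  + exact: L_beta_stationary.
  move=> f x z f1; apply: le_trans (L_beta_osc _ _ _ _ _ _ n_gt0 beta_ge0 f1) _.
  rewrite -/a -/k.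
  have kt : (1 - k) ^+ t <= expR (- (2 * l)).
    apply: (@le_trans _ _ (expR (- k) ^+ t)).
      apply: lerXn2r; rewrite ?nnegrE ?expR_ge0 //; first lra.
      exact: expR_ge1Dx.
    rewrite -expRM_natr ler_expR mulNr lerN2 [k * _]mulrC -ler_pdivrMr //.
    exact: ltW.
  have el : expR (- (2 * l)) = (eps / (2 * n%:R + 1)) ^+ 2.
    rewrite -mulrN mulrC expRM_natr /l -lnV ?posrE ?divr_gt0 // invf_div.
    by rewrite lnK // posrE divr_gt0.
  rewrite el in kt; apply: le_trans (ler_wpM2l _ kt) _.
    by rewrite addr_ge0 ?mulr_ge0 ?exprn_ge0 //; lra.
  rewrite expr_div_n mulrA ler_pdivrMr ?exprn_gt0 //.
  rewrite [eps ^+ 2]expr2 mulrCA ler_wpM2l ?(ltW eps_gt0) //.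
  have n20 : 0 <= n%:R ^+ 2 :> R by exact: exprn_ge0.
  have : (2 * n%:R ^+ 2 + 2) * eps <= (2 * n%:R ^+ 2 + 2) * 2.
    by rewrite ler_wpM2l //; lra.
  have -> : (2 * n%:R + 1) ^+ 2 = 4 * n%:R ^+ 2 + 4 * n%:R + 1 :> R by ring.
  clear -n20 n1; lra.
rewrite lee_fin; apply: (@le_trans _ _ (y + 1)).
  by rewrite /t -natr1 lerD2r.
have -> : y = 8 * n%:R / (1 - a) * l.
  by rewrite /y /k; field; rewrite gt_eqF //=; lra.
set q := (1 - a)^-1.
have q1 : 1 <= q by rewrite /q invf_ge1 //; lra.
have n3 : n%:R <= n%:R ^+ 3 :> R by rewrite -[leLHS]expr1 ler_weXn2l.
have ql : 3^-1 <= q * l by nra.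
have bn : 0 <= beta * n%:R by rewrite mulr_ge0.
have nql : n%:R * (q * l) <= n%:R ^+ 3 * (q * l) by rewrite ler_wpM2r //; lra.
have nql1 : 1 * (q * l) <= n%:R * (q * l) by rewrite ler_wpM2r //; lra.
have q0 : 0 <= q by lra.
have n30 : 0 <= n%:R ^+ 3 :> R by exact: exprn_ge0.
have := mulr_ge0 (mulr_ge0 n30 q0) bn.
lra.
Qed.

End Contraction.

(** * Slow mixing of the original kernel *)

Section Metastability.
Context {R : realType}.
Implicit Types (n : nat) (a beta eps : R) (h : nat -> R).

(** As a function of [k], this is harmonic for the walk killed at [0], except
    at the boundary point [n]; up to a constant, it is the probability of
    reaching [n] before [0]. *)
Definition geo_sum a (k : nat) : R := \sum_(j < k) a ^+ j.

Lemma geo_sumS a k : geo_sum a k.+1 = geo_sum a k + a ^+ k.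
Proof. by rewrite /geo_sum big_ord_recr. Qed.

Lemma geo_sum_ge1 a k : 0 <= a -> (0 < k)%N -> 1 <= geo_sum a k.
Proof.
move=> a0; case: k => // k _; rewrite /geo_sum big_ord_recl expr0 lerDl.
by apply: sumr_ge0 => j _; exact: exprn_ge0.
Qed.

Lemma geo_sum_le a j k : 0 <= a -> (j <= k)%N -> geo_sum a j <= geo_sum a k.
Proof.
move=> a0 /subnKC<-; elim: (k - j)%N => [|d IH]; first by rewrite addn0.
by rewrite addnS geo_sumS (le_trans IH) // lerDl exprn_ge0.
Qed.

(** Harmonicity makes this immediate for [k < n].  At [k = n] the missing jump
    to the right costs [a ^ n / 2], and [1 <= geo_sum a n] makes this a
    fraction at most [a ^ n / 2] of the value. *)
Lemma geo_sum_step n a k : (k <= n)%N -> 0 <= a -> a <= 1 ->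
  (1 - a ^+ n / 2) * geo_sum a k <= profile_step n a (-1) (geo_sum a) k.
Proof.
move=> kn a0 a1; have an : 0 <= a ^+ n by exact: exprn_ge0.
case: k kn => [|k] kn.
  by rewrite /profile_step /geo_sum big_ord0 mulr0 subrr mul0r mul0r.
have g1 : 1 <= geo_sum a k.+1 by exact: geo_sum_ge1.
have right : geo_sum a k.+2 - geo_sum a k.+1 = a * a ^+ k.
  by rewrite [geo_sum a k.+2]geo_sumS addrAC subrr add0r exprS.
have left : geo_sum a k - geo_sum a k.+1 = - a ^+ k.
  by rewrite geo_sumS opprD addNKr.
rewrite /profile_step right left; case: ifP => kn'.
  have := mulr_ge0 an (le_trans ler01 g1); lra.
have kE : n = k.+1 by lia.
have g1' : 0 <= geo_sum a k.+1 - 1 by rewrite subr_ge0.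
have := mulr_ge0 an g1'; rewrite kE exprS; lra.
Qed.

(** All coefficients of the killed step are nonnegative. *)
Lemma profile_step_mono n a b h h' k :
    0 <= a -> a <= 1 -> (k <= n)%N ->
    (forall j, (j <= n)%N -> b * h j <= h' j) ->
  b * profile_step n a (-1) h k <= profile_step n a (-1) h' k.
Proof.
move=> a0 a1 kn hh; case: k kn => [|k] kn.
  by rewrite /profile_step subrr !mul0r mulr0.
have := hh _ kn; have := ler_wpM2l a0 (hh _ (ltnW kn)).
have a1' : 0 <= 1 - a by lra.
have := ler_wpM2l a1' (hh _ kn).
rewrite /profile_step; case: ifP => [/hh|_]; lra.
Qed.

(** The odd function with profile [geo_sum] has mean zero and loses at each step
    at most the fraction [a ^ n / 2] of its value on the positive side; it is
    tested at the site [n], where its modulus is largest. *)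
Lemma P_beta_slow n beta t : (0 < n)%N -> 0 <= beta ->
  (1 - expR (- beta) ^+ n / 2) ^+ t <= d1 (pi_beta n beta) (P_beta n beta) t.
Proof.
move=> n0 b0; set a := expR (- beta).
have a0 : 0 <= a by exact: expR_ge0.
have a1 : a <= 1 by rewrite -expR0 ler_expR oppr_le0.
have an : a ^+ n <= 1 by exact: exprn_ile1.
set F := geo_sum a; set r := 1 - _.
have r0 : 0 <= r by rewrite /r; lra.
have Fn : 0 < F n by rewrite (lt_le_trans ltr01) ?geo_sum_ge1.
have F0 : F 0%N = 0 by rewrite /F /geo_sum big_ord0.
have s1 : (-1) * (-1) = 1 :> R by rewrite mulrNN mulr1.
have [h [hE [h0 hF]]] : exists h, P_beta n beta ^+ t *m profile n (-1) F
      = profile n (-1) h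
    /\ h 0%N = 0 /\ forall k, (k <= n)%N -> r ^+ t * F k <= h k.
  elim: t => [|t [h [hE [h0 hF]]]].
    exists F; rewrite expr0 mul1mx; split=> //; split=> // k _.
    by rewrite expr0 mul1r.
  exists (profile_step n a (-1) h); split; last split.
  - by rewrite exprS -mulmxE -mulmxA hE P_beta_profile // h0 mulr0.
  - by rewrite /profile_step subrr !mul0r.
  - move=> k kn; apply: le_trans (profile_step_mono _ _ _ F _ _ a0 a1 kn hF).
    by rewrite exprSr -mulrA ler_wpM2l ?exprn_ge0 // geo_sum_step.
rewrite -(ler_pM2r Fn).
have hn : height n n.*2 = n by rewrite /height; lia.
apply: le_trans (hF n (leqnn n)) _.
have -> : h n = (P_beta n beta ^+ t *m profile n (-1) F) ord_max 0.
  rewrite hE mxE /= hn; have -> : (n.*2 < n)%N = false by lia.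
  by rewrite mul1r.
apply: le_d1 => [y|].
  have Fy : 0 <= F (height n y) by apply: sumr_ge0 => j _; exact: exprn_ge0.
  have -> : `|(profile n (-1) F) y 0| = F (height n y).
    by rewrite mxE; case: ifP; rewrite ?mul1r ?mulN1r ?normrN ger0_norm.
  by apply: geo_sum_le => //; have := ltn_ord y; rewrite /height; lia.
set S := \sum_y _; suff : S = - S by lra.
rewrite {1}/S (reindex_inj rev_ord_inj) -sumrN; apply: eq_bigr => y _.
rewrite pi_beta_rev -reflectE reflect_profile ?F0 ?mulr0 //.
by rewrite mxE mulN1r mulrN.
Qed.

(** If [(1 - d) ^ t <= eps] then [t >= (1 / d - 1) * ln (1 / eps)].  Here
    [1 / d = 2 * expR (beta * n)], which is more than is asked for when
    [eps < 1].  When [eps >= 1] the logarithm changes sign, and the right-hand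
    side is at most [ln eps <= eps - 1 <= 1 <= t]. *)
Lemma le_tmix1_P_beta n beta eps :
    (0 < n)%N -> 0 <= beta -> 0 < eps -> eps <= 2 ->
  (((expR (beta * n%:R) / (2 * n%:R + 1) ^+ 2 - 1) * ln (1 / eps))%:E
     <= tmix1 (pi_beta n beta) (P_beta n beta) eps)%E.
Proof.
move=> n_gt0 beta_ge0 eps_gt0 eps_le2.
have n1 : 1 <= n%:R :> R by rewrite ler1n.
have m0 : 0 < 2 * n%:R + 1 :> R by lra.
apply/ereal_infP => _ [t [t0 d1t] <-]; rewrite lee_fin.
have t1 : 1 <= t%:R :> R by rewrite ler1n.
set c := _ / _ ^+ 2.
have c0 : 0 <= c by rewrite divr_ge0 ?expR_ge0 ?exprn_ge0 // ltW.
rewrite div1r lnV ?posrE //.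
case: (lerP 1 eps) => e1.
  have l0 : 0 <= ln eps by rewrite ln_ge0.
  have l1 := ln_leB1 _ eps_gt0.
  have := mulr_ge0 c0 l0; lra.
have l0 : 0 <= - ln eps by rewrite oppr_ge0 ln_le0 // ltW.
have := le_trans (P_beta_slow _ _ t n_gt0 beta_ge0) d1t.
rewrite -expRM_natr mulNr expRN; set E := expR _ => rt.
have E1 : 1 <= E by rewrite /E -expR0 ler_expR mulr_ge0.
have cE : c <= E.
  by rewrite /c ler_pdivrMr ?exprn_gt0 // ler_peMr ?exprn_ege1 //; lra.
set d := E^-1 / 2 in rt.
have d12 : d <= 2^-1.
  by rewrite /d ler_piMl // invf_le1 //; lra.
have d0 : 0 < d by rewrite divr_gt0 // invr_gt0; lra.
have rpos : 0 < (1 - d) ^+ t by rewrite exprn_gt0 //; lra.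
have : - ln eps <= t%:R * (d / (1 - d)).
  rewrite -lnV ?posrE //; apply: (@le_trans _ _ (ln ((1 - d)^-1 ^+ t))).
    rewrite ler_ln ?posrE ?invr_gt0 //; last first.
      by rewrite exprn_gt0 // invr_gt0; lra.
    by rewrite exprVn lef_pV2 ?posrE.
  rewrite lnXn ?invr_gt0; last lra.
  rewrite -[ln _ *+ t]mulr_natl ler_wpM2l //.
  have -> : d / (1 - d) = (1 - d)^-1 - 1 by field; lra.
  by apply: ln_leB1; rewrite invr_gt0; lra.
move=> lt; apply: le_trans (_ : (E - 1) * - ln eps <= _).
  by rewrite ler_wpM2r // lerD2r.
have Ed : d / (1 - d) * (E - 1) <= 1.
  have -> : d / (1 - d) = (2 * E - 1)^-1.
    by rewrite /d; field; apply/andP; split; lra.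
  rewrite mulrC ler_pdivrMr; lra.
rewrite mulrC; apply: le_trans (ler_wpM2r _ lt) _; first lra.
by rewrite -mulrA ler_piMr.
Qed.

End Metastability.

Theorem proposition7p3 (R : realType) (n : nat) (beta eps : R)
    (n_gt0 : (0 < n)%N) (beta_ge0 : 0 <= beta)
    (eps_gt0 : 0 < eps) (eps_le2 : eps <= 2) :
  (tmix1 (pi_beta n beta) (L_beta n beta) eps
     <= (if beta == 0%R then +oo
         else (72 * n%:R ^+ 3 / (1 - expR (- beta))
               * (beta * n%:R + ln ((2 * n%:R + 1) / eps)))%R%:E))%E
  /\
  (((expR (beta * n%:R) / (2 * n%:R + 1) ^+ 2 - 1) * ln (1 / eps))%R%:E
     <= tmix1 (pi_beta n beta) (P_beta n beta) eps)%E.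
Proof.
split; last exact: le_tmix1_P_beta.
case: eqVneq => [_|beta_neq0]; first exact: leey.
by apply: tmix1_L_beta_le => //; rewrite lt_def beta_neq0.
Qed.
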